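(* Let $H$ be a complex Hilbert space, let $n\ge 2$, and let $(\alpha_1,\dots,\alpha_n)$ be an $n$-tuple of unit vectors in $H$. Put $$\epsilon=\max\{|\langle\alpha_i,\alpha_j\rangle| : i,j=1,\dots,n,\ i\neq j\},$$ and suppose $\epsilon<\frac{1}{2(n-1)}$. Then there is an orthonormal basis $(\epsilon_1,\dots,\epsilon_n)$ of $\operatorname{span}\{\alpha_1,\dots,\alpha_n\}$ such that $$\sum_{i=1}^n\|\epsilon_i-\alpha_i\|^2\le 2(n-1)\epsilon.$$
   Context: An orthonormal basis here is an ordered $n$-tuple of orthonormal vectors $\epsilon_1,\dots,\epsilon_n$ spanning the given subspace (in particular the subspace has dimension $n$). *)

(* Defs.v *)
From HB Require Import structures.
From mathcomp Require Export all_boot all_order all_algebra.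
From mathcomp Require Export sesquilinear.
From mathcomp Require Export all_classical all_reals all_analysis.
From mathcomp Require Export complex.

Set Implicit Arguments.
Unset Strict Implicit.
Unset Printing Implicit Defensive.

Export Order.TTheory GRing.Theory Num.Theory.
Export numFieldNormedType.Exports.
Export ComplexField.

Local Open Scope ring_scope.
Local Open Scope classical_set_scope.

Section Defs.
Context {R : realType} {H : completeNormedModType R[i]} {n : nat}.
Implicit Types (dot : {dot H for Num.conj}) (a e : n.-tuple H) (V : set H).

(* A complex Hilbert space is presented as a complete normed space over R[i]
   together with a positive definite Hermitian form inducing its norm. *)
Definition induces_norm dot := forall x : H, `|x| ^+ 2 = dot x x.

Definition lin_span a : set H :=
  [set x | exists c : 'I_n -> R[i], x = \sum_(i < n) c i *: tnth a i].

Definition orthonormal_basis dot e V := orthonormal dot e /\ lin_span e = V.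

(* The moduli are nonnegative, so the default value 0 of the iterated maximum
   does not affect it as soon as n >= 2. *)
Definition coherence dot a : R :=
  \big[Num.max/0]_(p : 'I_n * 'I_n | p.1 != p.2)
    Normc.normc (dot (tnth a p.1) (tnth a p.2)).

End Defs.

(* Main.v *)
(* Let [G] be the Gram matrix of the unit vectors [alpha_i]. It differs from the
   identity by at most [n (n - 1) eps^2 < 1] in squared Frobenius norm, so its
   eigenvalues [d] are positive and the family [G^(-1/2) alpha] (symmetric
   orthonormalization) is an orthonormal basis of the span. Its squared distance
   to [alpha] is the sum of [(1 - sqrt d)^2 <= (1 - d)^2], which is at most
   [n (n - 1) eps^2 <= 2 (n - 1) eps]. *)
Require Import Defs.
From mathcomp Require Import spectral lra.

Local Open Scope ring_scope.
Local Open Scope complex_scope.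
Local Open Scope sesquilinear_scope.

Section UnitaryDiagonalization.
Context {C : numClosedFieldType} {n : nat}.
Variable P : 'M[C]_n.
Hypothesis P_unitary : P \is unitarymx.

(** Functional calculus: if [P] diagonalizes a matrix with eigenvalues [d], applying a function
    entrywise to [d] gives that function of the matrix. The lemmas below reduce matrix identities to
    scalar ones. *)
Definition diag_conj (a : 'rV[C]_n) : 'M[C]_n := P^t* *m diag_mx a *m P.

Lemma diag_conjM a b :
  diag_conj a *m diag_conj b = diag_conj (\row_i (a 0 i * b 0 i)).
Proof.
rewrite /diag_conj !mulmxA mulmxtVK // -[_ *m diag_mx a *m _]mulmxA.
by rewrite mulmx_diag.
Qed.

Lemma diag_conjB a b : diag_conj (a - b) = diag_conj a - diag_conj b.
Proof. by rewrite /diag_conj linearB /= mulmxBr mulmxBl. Qed.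

Lemma diag_conj1 : diag_conj (const_mx 1) = 1%:M.
Proof.
rewrite /diag_conj diag_const_mx mulmx1 -invmx_unitary //.
by rewrite mulVmx ?unitarymx_unit.
Qed.

Lemma diag_conj_real a : a \is a realmx -> (diag_conj a)^t* = diag_conj a.
Proof.
move=> a_real; rewrite /diag_conj !trmx_mul !map_mxM /= tr_diag_mx map_diag_mx.
by rewrite (realmxC a_real) trmxCK mulmxA.
Qed.

Lemma mxtrace_diag_conj a : \tr (diag_conj a) = \sum_i a 0 i.
Proof.
rewrite /diag_conj mxtrace_mulC mulmxA (unitarymxP P_unitary) mul1mx.
exact: mxtrace_diag.
Qed.

End UnitaryDiagonalization.

(** Writes the squared Frobenius norm as a trace, which can be read off the eigenvalues. *)
Lemma mxtrace_mul_adjoint {C : numClosedFieldType} {m n} (A : 'M[C]_(m, n)) :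
  \tr (A *m A^t*) = \sum_i \sum_j `|A i j| ^+ 2.
Proof.
apply: eq_bigr => i _; rewrite mxE; apply: eq_bigr => j _.
by rewrite !mxE normCK.
Qed.

Lemma realmxB {C : numClosedFieldType} {m n} (A B : 'M[C]_(m, n)) :
  A \is a realmx -> B \is a realmx -> A - B \is a realmx.
Proof.
move=> /mxOverP rA /mxOverP rB; apply/mxOverP => i j.
by rewrite !mxE rpredB.
Qed.

(* The witness is [G^(-1/2)]. *)
Lemma symmetric_orthonormalization {C : numClosedFieldType} {n} {G : 'M[C]_n} :
    G \is hermsymmx -> \sum_i \sum_j `|(G - 1%:M) i j| ^+ 2 < 1 ->
  exists2 S : 'M[C]_n, S \in unitmx &
    S *m G *m S^t* = 1%:M /\
    \tr ((S - 1%:M) *m G *m (S - 1%:M)^t*)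
      <= \sum_i \sum_j `|(G - 1%:M) i j| ^+ 2.
Proof.
move=> G_herm; rewrite -mxtrace_mul_adjoint.
set P := spectralmx G; set d := spectral_diag G.
have P_unit : P \is unitarymx := spectral_unitarymx G.
have d_real : d \is a realmx := hermitian_spectral_diag_real G_herm.
have dR i : d 0 i \is Num.real by move/mxOverP: d_real; apply.
have dB1 i : d 0 i - 1 \is Num.real by rewrite realB ?real1.
have one_real : (const_mx 1 : 'rV[C]_n) \is a realmx.
  by apply/mxOverP => i j; rewrite mxE.
have GE : G = diag_conj P d.
  have /hermitian_normalmx/orthomx_spectralP := G_herm.
  by rewrite invmx_unitary.
have GBE : G - 1%:M = diag_conj P (d - const_mx 1).
  by rewrite diag_conjB diag_conj1 // -GE.
have -> : \tr ((G - 1%:M) *m (G - 1%:M)^t*) = \sum_i (d 0 i - 1) ^+ 2.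
  rewrite GBE diag_conj_real ?realmxB // diag_conjM // mxtrace_diag_conj //.
  by apply: eq_bigr => i _; rewrite !mxE.
move=> sum_lt1.
(* A single term of the sum is already below 1, so [d 0 i] lies within distance less than 1 of 1. *)
have d_gt0 i : 0 < d 0 i.
  have sq_ge0 j : 0 <= (d 0 j - 1) ^+ 2.
    exact: real_exprn_even_ge0.
  have : (d 0 i - 1) ^+ 2 < 1.
    apply: le_lt_trans sum_lt1; rewrite (bigD1 i) //= lerDl.
    exact: sumr_ge0.
  rewrite -real_normK // -[X in _ < X](expr1n _ 2).
  rewrite ltr_pXn2r ?nnegrE // real_ltr_norml //.
  by rewrite ltrBrDl subrr => /andP[].
(* These are the spectra of [G^(1/2)] and [G^(-1/2)]; the former supplies the inverse of the
   witness. *)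
pose r := \row_i sqrtC (d 0 i); pose s := \row_i (sqrtC (d 0 i))^-1.
have r_gt0 i : 0 < sqrtC (d 0 i) by rewrite sqrtC_gt0.
have s_real : s \is a realmx.
  by apply/mxOverP => i j; rewrite !mxE rpredV gtr0_real.
exists (diag_conj P s).
  apply: (proj1 (mulmx1_unit (B := diag_conj P r) _)).
  rewrite diag_conjM // -(diag_conj1 P P_unit); congr diag_conj.
  by apply/rowP => i; rewrite !mxE mulVf ?gt_eqF.
have SBE : diag_conj P s - 1%:M = diag_conj P (s - const_mx 1).
  by rewrite diag_conjB diag_conj1.
split.
  rewrite diag_conj_real // GE !diag_conjM // -(diag_conj1 P P_unit).
  congr diag_conj; apply/rowP => i; rewrite !mxE.
  by rewrite -{2}[d 0 i]sqrtCK expr2 mulKf ?gt_eqF // divff ?gt_eqF.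
rewrite SBE diag_conj_real ?realmxB // GE !diag_conjM // mxtrace_diag_conj //.
apply: ler_sum => i _; rewrite !mxE.
set t := sqrtC (d 0 i); have t_gt0 : 0 < t := r_gt0 i.
rewrite -[d 0 i]sqrtCK -/t.
have tN0 : t != 0 by rewrite gt_eqF.
(* With [t ^+ 2] the eigenvalue, the left side becomes [(t - 1)^2] and the right side
   [(t - 1)^2 (t + 1)^2], whose extra factor is at least 1 because [t > 0]. *)
have -> : (t^-1 - 1) * t ^+ 2 * (t^-1 - 1) = (t - 1) ^+ 2.
  rewrite mulrAC -expr2 -exprMn mulrBl mulVf // mul1r -sqrrN opprB //.
have -> : (t ^+ 2 - 1) ^+ 2 = (t - 1) ^+ 2 * (t + 1) ^+ 2.
  by rewrite -exprMn -subr_sqr_1.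
rewrite ler_peMr //.
  by apply: real_exprn_even_ge0; rewrite // realB ?real1 ?gtr0_real.
by rewrite exprn_ege1 // lerDr ltW.
Qed.

Section Gram.
Context {C : numClosedFieldType} {U : lmodType C} {n : nat}.
Variables (dot : {dot U for Num.conj}) (a : 'I_n -> U).

Definition gram : 'M[C]_n := \matrix_(i, j) dot (a i) (a j).

Definition lincomb (A : 'M[C]_n) (i : 'I_n) : U := \sum_j A i j *: a j.

Lemma gram_hermitian : gram \is hermsymmx.
Proof.
by apply/is_hermitianmxP/matrixP => i j; rewrite !mxE hermC.
Qed.

(** The form is conjugate-linear in its second argument, so [B] enters through its adjoint.
    Orthonormality and distances thus become matrix statements about [gram]. *)
Lemma dot_lincomb A B i k :
  dot (lincomb A i) (lincomb B k) = (A *m gram *m B^t*) i k.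
Proof.
rewrite /lincomb linear_sumr mxE; apply: eq_bigr => l _.
rewrite linearZr_LR /= linear_sumlz !mxE mulrC; congr (_ * _).
by apply: eq_bigr => j _; rewrite linearZl_LR mxE.
Qed.

Lemma lincomb1 i : lincomb 1%:M i = a i.
Proof.
rewrite /lincomb (bigD1 i) //= mxE eqxx scale1r big1 ?addr0 // => j.
by rewrite mxE eq_sym => /negPf ->; rewrite scale0r.
Qed.

Lemma lincombB A B i : lincomb (A - B) i = lincomb A i - lincomb B i.
Proof.
rewrite /lincomb -sumrB; apply: eq_bigr => j _.
by rewrite !mxE scalerBl.
Qed.

Lemma lincombM A B i : lincomb (A *m B) i = \sum_j A i j *: lincomb B j.
Proof.
rewrite /lincomb; under [RHS]eq_bigr do rewrite scaler_sumr.
rewrite exchange_big; apply: eq_bigr => j _ /=.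
by rewrite mxE scaler_suml; apply: eq_bigr => k _; rewrite scalerA.
Qed.

End Gram.

(** [orthonormalP] compares vectors, not indices, so [f] must be injective: equal vectors at
    distinct indices would give [1 = 0]. *)
Lemma orthonormal_mktuple {C : numClosedFieldType} {U : lmodType C} {n}
    {dot : {dot U for Num.conj}} {f : 'I_n -> U} :
  (forall i j, dot (f i) (f j) = (i == j)%:R) -> orthonormal dot (mktuple f).
Proof.
move=> f_on; have f_inj : injective f.
  move=> i j fij; apply/eqP/negPn/negP => /negPf ij.
  have := f_on i j; rewrite ij fij f_on eqxx => /eqP.
  by rewrite oner_eq0.
apply/orthonormalP; split.
  by rewrite map_inj_uniq ?enum_uniq.
move=> _ _ /mapP[i _ ->] /mapP[j _ ->].
by rewrite f_on (inj_eq f_inj).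
Qed.

Section Span.
Context {R : realType} {H : completeNormedModType R[i]} {n : nat}.

(** The coefficient row [c] is multiplied on the right by [S] for one inclusion and by [invmx S] for
    the other. *)
Lemma lin_span_lincomb (a : n.-tuple H) (S : 'M[R[i]]_n) : S \in unitmx ->
  lin_span (mktuple (lincomb (tnth a) S)) = lin_span a.
Proof.
move=> S_unit; apply/seteqP; split => x [c ->].
  exists (fun j => \sum_i c i * S i j).
  under [RHS]eq_bigr do rewrite scaler_suml.
  rewrite exchange_big; apply: eq_bigr => i _ /=.
  rewrite tnth_mktuple scaler_sumr; apply: eq_bigr => j _.
  by rewrite scalerA.
exists (fun j => \sum_i c i * invmx S i j).
under [RHS]eq_bigr do rewrite scaler_suml tnth_mktuple.
rewrite exchange_big; apply: eq_bigr => i _ /=.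
rewrite -[tnth a i]lincomb1 -(mulVmx S_unit) lincombM scaler_sumr.
by apply: eq_bigr => j _; rewrite scalerA.
Qed.

Lemma coherence_ge {dot : {dot H for Num.conj}} {a : n.-tuple H} {i j} :
  i != j -> `|dot (tnth a i) (tnth a j)| <= (coherence dot a)%:C.
Proof.
(* The norm on [R[i]] is the real modulus embedded in [R[i]], so the comparison descends to [R]. *)
move=> ij; rewrite -[`|_|]/(Normc.normc (dot (tnth a i) (tnth a j)))%:C.
rewrite lecR /coherence.
exact: (le_bigmax_cond 0
  (fun p : 'I_n * 'I_n => Normc.normc (dot (tnth a p.1) (tnth a p.2)))
  (j := (i, j))).
Qed.

Lemma coherence_ge0 (dot : {dot H for Num.conj}) (a : n.-tuple H) :
  0 <= coherence dot a.
Proof. exact: bigmax_ge_id. Qed.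

(** Unit vectors make the diagonal of [G - 1] vanish, and each row has [n - 1] other entries, of
    modulus at most the coherence. *)
Lemma gram_frobenius_le {dot : {dot H for Num.conj}} {a : n.-tuple H} :
    induces_norm dot -> (forall i, `|tnth a i| = 1) ->
  \sum_i \sum_j `|(gram dot (tnth a) - 1%:M) i j| ^+ 2
    <= (n%:R * (n%:R - 1) * coherence dot a ^+ 2)%:C.
Proof.
move=> dotE a_unit.
have row_le i : \sum_j `|(gram dot (tnth a) - 1%:M) i j| ^+ 2
    <= ((n%:R - 1) * coherence dot a ^+ 2)%:C.
  rewrite (bigD1 i) //= !mxE eqxx -dotE a_unit expr1n subrr normr0 expr0n add0r.
  have -> : ((n%:R - 1) * coherence dot a ^+ 2)%:C
      = \sum_(j < n | j != i) ((coherence dot a)%:C ^+ 2).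
    rewrite sumr_const cardC1 card_ord -rmorphXn -rmorphMn /=.
    congr _%:C; rewrite -[RHS]mulr_natl -subn1 natrB //.
    (* The index [i] forces [1 <= n], so the truncated subtraction agrees with [n - 1] in [R]. *)
    exact: leq_ltn_trans (ltn_ord i).
  apply: ler_sum => j ji; rewrite !mxE eq_sym (negPf ji) subr0.
  rewrite ler_pXn2r ?nnegrE // ?coherence_ge //; first by rewrite eq_sym.
  by rewrite lecR coherence_ge0.
apply: le_trans (ler_sum _ (fun i _ => row_le i)) _.
by rewrite sumr_const card_ord -rmorphMn /= lecR -[leLHS]mulr_natl mulrA.
Qed.

End Span.

Theorem theorem4p4 (R : realType) (H : completeNormedModType R[i])
    (dot : {dot H for Num.conj}) (dotE : induces_norm dot)
    (n : nat) (n_ge2 : (2 <= n)%N)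
    (alpha : n.-tuple H) (alpha_unit : forall i : 'I_n, `|tnth alpha i| = 1)
    (eps_small : coherence dot alpha < 1 / (2 * (n%:R - 1))) :
  exists2 e : n.-tuple H,
    orthonormal_basis dot e (lin_span alpha) &
    \sum_(i < n) `|tnth e i - tnth alpha i| ^+ 2
      <= (2 * (n%:R - 1) * coherence dot alpha)%:C.
Proof.
have frob_le := gram_frobenius_le dotE alpha_unit.
have eps_ge0 := coherence_ge0 dot alpha.
set eps := coherence dot alpha in eps_small frob_le eps_ge0 *.
have nR_ge2 : 2 <= n%:R :> R by rewrite (ler_nat R 2 n).
have eps_lt : 2 * (n%:R - 1) * eps < 1.
  by move: eps_small; rewrite ltr_pdivlMr 1?mulrC //; lra.
(* Since [n <= 2 (n - 1)] for [n >= 2], [n eps <= 1]; multiplying by [(n - 1) eps] bounds the left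
   side by [(n - 1) eps]. *)
have frob_bound : n%:R * (n%:R - 1) * eps ^+ 2 <= 2 * (n%:R - 1) * eps.
  have n_eps_le1 : n%:R * eps <= 1.
    by apply: le_trans (ltW eps_lt); rewrite ler_wpM2r //; lra.
  have : (n%:R - 1) * eps * (n%:R * eps) <= (n%:R - 1) * eps * 1.
    by rewrite ler_wpM2l // mulr_ge0 //; lra.
  have : 0 <= (n%:R - 1) * eps by rewrite mulr_ge0 //; lra.
  lra.
have [] := symmetric_orthonormalization (gram_hermitian dot (tnth alpha)).
  apply: le_lt_trans frob_le _; rewrite -(rmorph1 (real_complex R)) ltcR.
  exact: le_lt_trans eps_lt.
move=> S S_unit [S_on S_le]; exists (mktuple (lincomb (tnth alpha) S)).
  split; last exact: lin_span_lincomb.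
  by apply: orthonormal_mktuple => i j; rewrite dot_lincomb S_on mxE.
(* Each difference is a row of [lincomb] for [S - 1], so its squared norm is a diagonal entry of the
   matrix under the trace. *)
have -> :
    \sum_i `|tnth (mktuple (lincomb (tnth alpha) S)) i - tnth alpha i| ^+ 2 =
      \tr ((S - 1%:M) *m gram dot (tnth alpha) *m (S - 1%:M)^t*).
  apply: eq_bigr => i _; rewrite tnth_mktuple dotE.
  by rewrite -[tnth alpha i](lincomb1 (tnth alpha)) -lincombB dot_lincomb.
apply: le_trans S_le _; apply: le_trans frob_le _.
by rewrite lecR.
Qed.
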